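(* For $n\ge1$ define: $p_1(n)$ is the weighted count of partitions $\pi$ of $n$ whose largest part is even, say $2m$, (the largest part may repeat) and all of whose parts smaller than the largest part are odd, pairwise distinct, and different from $2m-1$; each such $\pi$ is counted with weight $(-1)^{\#_o(\pi)}$, where $\#_o(\pi)$ is the number of odd parts of $\pi$. $p_2(n)$ is the weighted count of partitions $\pi$ of $n$ whose largest part is even, say $2m$, and in which no integer $k$ with $m\le k\le 2m-1$ appears as a part; each such $\pi$ is counted with weight $(-1)^{\#(\pi)-\lambda(\pi)}$, where $\#(\pi)$ is the number of parts of $\pi$ and $\lambda(\pi)$ is the multiplicity of the largest part. $\tau_e(n)$ and $\tau_o(n)$ denote the number of even and odd positive divisors of $n$, respectively. Then for every $n\ge1$, \[ p_1(n)-p_1(n+1)=p_2(n)+\tau_e(n)-\tau_o(n), \] and consequently, for every $N\ge1$, \[ p_1(N)=\sum_{n=1}^{N-1}\left(\tau_o(n)-\tau_e(n)-p_2(n)\right). \] *)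

(* Defs.v *)
From mathcomp Require Import all_boot all_order all_algebra.

Set Implicit Arguments.
Unset Strict Implicit.
Unset Printing Implicit Defensive.

Import GRing.Theory.

Definition is_partition (n : nat) (s : seq nat) : bool :=
  [&& sorted geq s, 0 \notin s & sumn s == n].

(* A partition of n has at most n parts, each at most n; [mem_partitions] and
   [partitions_uniq] below show that the list is exhaustive and has no
   repetitions. *)
Definition partitions (n : nat) : seq (seq nat) :=
  [seq s <- [seq map val (t : seq 'I_n.+1) | t : n.-bseq 'I_n.+1]
  | is_partition n s].

Lemma partitions_uniq n : uniq (partitions n).
Proof.
rewrite filter_uniq // map_inj_uniq ?enum_uniq // => s t /= est.
by apply: val_inj; apply: (inj_map val_inj).
Qed.

Lemma leq_mem_sumn (s : seq nat) k : k \in s -> k <= sumn s.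
Proof.
elim: s => //= x s IHs; rewrite inE => /orP[/eqP -> | /IHs le_k].
  exact: leq_addr.
exact: leq_trans le_k (leq_addl _ _).
Qed.

Lemma size_leq_sumn (s : seq nat) : 0 \notin s -> size s <= sumn s.
Proof.
elim: s => //= x s IHs; rewrite inE negb_or eq_sym -lt0n => /andP[x_gt0 /IHs].
by move=> le_s; rewrite -add1n leq_add.
Qed.

Lemma mem_partitions n s : (s \in partitions n) = is_partition n s.
Proof.
rewrite mem_filter; case: (boolP (is_partition n s)) => //= ps.
case/and3P: (ps) => _ s0 /eqP sum_s.
have sz_s : size (map (@inord n) s) <= n.
  by rewrite size_map (leq_trans (size_leq_sumn s0)) ?sum_s.
apply/mapP; exists (Bseq sz_s); first by rewrite mem_enum.
rewrite /= -map_comp -[LHS]map_id; apply/eq_in_map => k ks /=.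
by rewrite inordK // ltnS -sum_s leq_mem_sumn.
Qed.

Definition largest (s : seq nat) : nat := \max_(k <- s) k.

Definition largest_mult (s : seq nat) : nat := count_mem (largest s) s.

Definition p1_admissible (s : seq nat) : bool :=
  let smaller := [seq k <- s | k < largest s] in
  [&& ~~ odd (largest s), uniq smaller
    & all (fun k => odd k && (k != largest s - 1)) smaller].

Definition p2_admissible (s : seq nat) : bool :=
  let m := (largest s)./2 in
  ~~ odd (largest s) && all (fun k => ~~ (m <= k <= 2 * m - 1)) s.

Definition p1 (n : nat) : int :=
  (\sum_(s <- partitions n | p1_admissible s) (-1) ^+ count odd s)%R.

Definition p2 (n : nat) : int :=
  (\sum_(s <- partitions n | p2_admissible s)
     (-1) ^+ (size s - largest_mult s)%N)%R.

Definition tau_e (n : nat) : nat := count (fun d => ~~ odd d) (divisors n).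

Definition tau_o (n : nat) : nat := count odd (divisors n).

(* Main.v *)
Require Import Defs.
From mathcomp Require Import all_boot all_order all_algebra.
From mathcomp Require Import ring zify.

(** Write (a)_m for (a; q)_m. The generating functions are
    P1 = sum_m q^(2m)/(1-q^(2m)) (q; q^2)_(m-1),
    P2 = sum_m q^(2m)/(1-q^(2m)) / (-q)_(m-1),
    C = sum_k q^k/(1+q^k) for tau_o - tau_e,
    and the claim is (1-q) P1 + q P2 = q C.
    With E = (q; q^2)_oo = 1/(-q)_oo, telescoping gives
    (1-q) P1 = q (1-E) - q B and P2 = A - (1-E), where
    A = sum_m q^m/(1-q^m) / (-q)_m and B = sum_m q^(2m)/(1-q^(2m)) (q; q^2)_m,
    so one needs A - B = C.
    Replace (-q)_m by (-q^(i+1))_m in A and (q; q^2)_m by (q^(2i+1); q^2)_m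
    in B. Passing from i to i+1 changes both sums by telescoping series, and
    both become Lambert series as i grows; hence
    A = sum_k q^k/(1-q^k) + C - E sum_i ((-q)_oo - (-q)_i),
    B = sum_k q^(2k)/(1-q^(2k)) - E sum_i ((-q)_oo - 1/(q; q^2)_(i+1)).
    With Gaussian binomials in base q^2, (-q)_i = sum_r q^r [i, r] and
    1/(q; q^2)_(i+1) = sum_r q^r [i+r, r]. For fixed r these are the same
    sequence, shifted by r places, with limit 1/(q^2; q^2)_r. Therefore
    sum_i (1/(q; q^2)_(i+1) - (-q)_i) = sum_r r q^r/(q^2; q^2)_r, which is the
    derivative of 1/(zq; q^2)_oo at z = 1, namely
    1/E sum_k q^(2k+1)/(1-q^(2k+1)). The Lambert series cancel.

    Power series are replaced by elements of a commutative ring in which q is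
    nilpotent; coefficients are read off in Z[X]/(X^(n+2)). *)

Set Implicit Arguments.
Unset Strict Implicit.
Unset Printing Implicit Defensive.

Import GRing.Theory.
Local Open Scope ring_scope.

Section BigOpRanges.

Variables (T : Type) (idx : T) (op : Monoid.law idx).

Lemma big_nat_trunc m n p (F : nat -> T) : (n <= p)%N ->
  (forall i, (n <= i)%N -> F i = idx) ->
  \big[op/idx]_(m <= i < p) F i = \big[op/idx]_(m <= i < n) F i.
Proof.
move=> le_np F1; have [le_nm|lt_mn] := leqP n m.
  rewrite [RHS]big_geq // big1_seq // => i /andP[_].
  by rewrite mem_index_iota => /andP[/(leq_trans le_nm) /F1].
rewrite (big_cat_nat _ le_np) ?(ltnW lt_mn) //=.
rewrite [X in op _ X]big1_seq ?Monoid.mulm1 // => i /andP[_].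
by rewrite mem_index_iota => /andP[/F1].
Qed.

Lemma big_ord_trunc n p (F : nat -> T) : (n <= p)%N ->
  (forall i, (n <= i)%N -> F i = idx) ->
  \big[op/idx]_(i < p) F i = \big[op/idx]_(i < n) F i.
Proof. by rewrite -!(big_mkord xpredT F); apply: big_nat_trunc. Qed.

Lemma big_ord_double n (F : nat -> T) :
  \big[op/idx]_(i < 2 * n) F i =
  \big[op/idx]_(i < n) op (F (2 * i)%N) (F (2 * i).+1).
Proof.
elim: n => [|n IHn]; first by rewrite muln0 !big_ord0.
by rewrite mulnS !addSn add0n !big_ord_recr /= IHn Monoid.mulmA.
Qed.

End BigOpRanges.

Lemma sum_ord_odd (V : nmodType) N (a : nat -> V) :
  (forall t, (N <= t)%N -> a t = 0) ->
  \sum_(t < N | odd t) a t = \sum_(m < N) a (2 * m).+1.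
Proof.
move=> a0; have leN2N : (N <= 2 * N)%N by rewrite leq_pmull.
pose b t := if odd t then a t else 0; rewrite big_mkcond -/b.
rewrite -(big_ord_trunc (F := b) _ leN2N) => [|t /a0 a_t0]; last first.
  by rewrite /b a_t0 if_same.
rewrite big_ord_double; apply: eq_bigr => m _.
by rewrite /b /= mul2n odd_double add0r.
Qed.

Lemma sum_antidiag (V : nmodType) n (F : nat -> nat -> V) :
  \sum_(i < n) \sum_(r < i.+1) F r (i - r)%N =
  \sum_(r < n) \sum_(j < n - r) F r j.
Proof.
transitivity (\sum_(i < n) \sum_(r < n | (r <= i)%N) F r (i - r)%N).
  by apply: eq_bigr => i _; rewrite (big_ord_widen n (fun r => F r (i - r)%N)).
rewrite (exchange_big_dep xpredT) //=; apply: eq_bigr => r _.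
rewrite -(big_mkord (fun i => r <= i)%N (fun i => F r (i - r)%N)).
rewrite -(big_nat_widenl r 0 n xpredT) // -{1}[r : nat]add0n big_addn big_mkord.
by apply: eq_bigr => j _; rewrite addnK.
Qed.

Lemma prod_if0 (R : comPzSemiRingType) (I : finType) (b : pred I) (F : I -> R) :
  \prod_i (if b i then F i else 0) = if [forall i, b i] then \prod_i F i else 0.
Proof.
case: forallP => [all_b|not_all]; first by apply: eq_bigr => i _; rewrite all_b.
have /existsP[i /negbTE bi] : [exists i, ~~ b i].
  by rewrite -negb_forall; apply/forallP.
by rewrite (bigD1 i) //= bi mul0r.
Qed.

Lemma prod_inv_tail (R : comPzSemiRingType) (f g : nat -> R) i n :
    (i <= n)%N -> (forall s, f s * g s = 1) ->
  \prod_(i <= s < n) f s = (\prod_(s < n) f s) * \prod_(s < i) g s.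
Proof.
move=> le_in fg1; rewrite -!(big_mkord xpredT) (big_cat_nat (leq0n i) le_in) /=.
by rewrite mulrAC -big_split /= [X in X * _]big1 ?mul1r.
Qed.

(** * Gaussian binomials *)

(* The complete homogeneous symmetric polynomial of degree r at
   1, x, ..., x ^+ m.-1, i.e. the Gaussian binomial [m + r - 1, r] in base x. *)
Fixpoint qmultichoose (R : pzSemiRingType) (x : R) (m : nat) : nat -> R :=
  if m isn't m'.+1 then fun r => (r == 0%N)%:R
  else fix choose r :=
    if r isn't r'.+1 then 1 else qmultichoose x m' r'.+1 + x ^+ m' * choose r'.
Arguments qmultichoose : simpl never.

Section GaussianBinomials.

Variables (R : comPzRingType) (x : R).

Lemma qmultichoose0n r : qmultichoose x 0 r = (r == 0%N)%:R.
Proof. by []. Qed.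

Lemma qmultichoosen0 m : qmultichoose x m 0 = 1.
Proof. by case: m. Qed.

Lemma qmultichooseSS m r : qmultichoose x m.+1 r.+1 =
  qmultichoose x m r.+1 + x ^+ m * qmultichoose x m.+1 r.
Proof. by []. Qed.

Lemma qmultichooseSS_dual m r : qmultichoose x m.+1 r.+1 =
  qmultichoose x m.+1 r + x ^+ r.+1 * qmultichoose x m r.+1.
Proof.
elim: m r => [|m IHm] r.
  by rewrite qmultichooseSS !qmultichoose0n /= expr0; ring.
elim: r => [|r IHr].
  rewrite qmultichooseSS {1}IHm !qmultichoosen0.
  rewrite [qmultichoose x m.+1 1]qmultichooseSS qmultichoosen0.
  by rewrite [x ^+ m.+1]exprS; ring.
rewrite [LHS]qmultichooseSS {1}IHm {1}IHr.
rewrite [qmultichoose x m.+2 r.+1]qmultichooseSS.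
by rewrite [qmultichoose x m.+1 r.+2]qmultichooseSS !exprS; ring.
Qed.

Lemma qmultichoose1n r : qmultichoose x 1 r = 1.
Proof. by elim: r => // r IHr; rewrite qmultichooseSS_dual IHr mulr0 addr0. Qed.

Lemma qmultichoose_sym j r : qmultichoose x j.+1 r = qmultichoose x r.+1 j.
Proof.
elim: j r => [|j IHj] r; first by rewrite qmultichoose1n qmultichoosen0.
elim: r => [|r IHr]; first by rewrite qmultichoose1n qmultichoosen0.
by rewrite qmultichooseSS [RHS]qmultichooseSS_dual IHj IHr.
Qed.

End GaussianBinomials.

(* Fine's refinement of Euler's theorem on distinct and odd parts: the
   Rogers-Szego polynomials in base q ^+ 2 factor at q. *)
Lemma sum_qmultichoose_antidiag (R : comPzRingType) (q : R) i :
  \sum_(r < i.+1) q ^+ r * qmultichoose (q ^+ 2) (i - r).+1 r =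
  \prod_(s < i) (1 + q ^+ s.+1).
Proof.
elim: i => [|i IHi]; first by rewrite big_ord1 big_ord0 mul1r.
rewrite [RHS]big_ord_recr /= -IHi big_ord_recl /= expr0 mul1r qmultichoosen0.
pose h r j := qmultichoose (q ^+ 2) j r.
transitivity (1 + \sum_(r < i.+1) q ^+ r.+1 * h r.+1 (i - r)%N +
              \sum_(r < i.+1) q ^+ i.+1 * (q ^+ (i - r) * h r (i - r).+1)).
  rewrite -addrA -big_split; congr (1 + _); apply: eq_bigr => r _ /=.
  rewrite /bump /= add1n subSS qmultichooseSS mulrDr; congr (_ + _).
  rewrite -exprM !mulrA -!exprD; congr (q ^+ _ * _).
  by have := ltn_ord r; lia.
rewrite mulrDr mulr1; congr (_ + _).
  rewrite big_ord_recr /= subnn mulr0 addr0 [RHS]big_ord_recl /=.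
  rewrite expr0 mul1r qmultichoosen0.
  congr (_ + _); apply: eq_bigr => r _; rewrite /bump /= add1n /h.
  by rewrite subnSK.
rewrite -mulr_sumr mulrC; congr (_ * _); rewrite (reindex_inj rev_ord_inj) /=.
apply: eq_bigr => r _; rewrite subSS subKn -1?ltnS //.
by rewrite /h qmultichoose_sym.
Qed.

(** * Telescoping Lambert series *)

Section LambertTelescope.

Variables (R : comPzRingType) (a b x y : R) (inv_sub u v : nat -> R).
Hypothesis inv_subP : forall m, (1 - x ^+ m.+1) * inv_sub m = 1.
Hypothesis vP : forall s, (1 - b * (y * x ^+ s)) * v s = 1.
Hypothesis uE : forall s, u s = (1 - a * (y * x ^+ s)) * v s.

Lemma lambert_shift_diff M i :
  \sum_(m < M) x ^+ m.+1 * inv_sub m * \prod_(i.+1 <= s < i.+1 + m.+1) u s -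
  \sum_(m < M) x ^+ m.+1 * inv_sub m * \prod_(i <= s < i + m.+1) u s =
  v i * (1 - \prod_(i.+1 <= s < i.+1 + M) u s).
Proof.
rewrite -sumrB; pose w m := \prod_(i.+1 <= s < i.+1 + m) u s.
transitivity (\sum_(0 <= m < M) (v i * (- w m.+1) - v i * (- w m))); last first.
  have w0 : w 0%N = 1 by rewrite /w addn0 big_geq.
  by rewrite telescope_sumr // w0 -/(w M); ring.
rewrite big_mkord; apply: eq_bigr => m _.
have -> : \prod_(i <= s < i + m.+1) u s = u i * w m.
  by rewrite big_ltn ?addnS ?leq_addr // /w addSn.
have wS : w m.+1 = w m * u (i.+1 + m)%N.
  by rewrite /w addnS big_nat_recr //= leq_addr.
have yxS : y * x ^+ (i.+1 + m) = y * x ^+ i * x ^+ m.+1.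
  by rewrite addSnnS exprD mulrA.
have := inv_subP m; have := vP i; have := vP (i.+1 + m)%N.
rewrite -/(w m.+1) wS !uE yxS; set X := x ^+ m.+1; set Y := y * x ^+ i.
move: (w m) (v i) (v (i.+1 + m)%N) (inv_sub m) => W v0 v1 j v1P v0P jP.
transitivity (X * j * W * ((1 - a * (Y * X)) * v1 * ((1 - b * Y) * v0) -
                           (1 - a * Y) * v0 * ((1 - b * (Y * X)) * v1))).
  by rewrite v0P v1P; ring.
transitivity ((1 - X) * j *
    (v0 * W * ((1 - b * (Y * X)) * v1 - (1 - a * (Y * X)) * v1))).
  by ring.
by rewrite jP v1P; ring.
Qed.

Lemma lambert_telescope N M :
    (N <= M)%N -> (forall s, (N <= s)%N -> y * x ^+ s = 0) ->
  \sum_(m < M) x ^+ m.+1 * inv_sub m * \prod_(s < m.+1) u s =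
  \sum_(m < M) x ^+ m.+1 * inv_sub m -
    \sum_(i < N) v i * (1 - \prod_(i.+1 <= s < N) u s).
Proof.
move=> leNM yx0.
pose T i := \sum_(m < M) x ^+ m.+1 * inv_sub m * \prod_(i <= s < i + m.+1) u s.
have u1 s : (N <= s)%N -> u s = 1.
  by move=> /yx0 e; rewrite -(vP s) uE e !mulr0.
have -> : \sum_(m < M) x ^+ m.+1 * inv_sub m = T N.
  apply: eq_bigr => m _; rewrite big1_seq ?mulr1 // => s.
  by rewrite mem_index_iota => /andP[_ /andP[/u1]].
transitivity (T 0%N); first by apply: eq_bigr => m _; rewrite big_mkord.
suff -> : \sum_(i < N) v i * (1 - \prod_(i.+1 <= s < N) u s) = T N - T 0%N.
  by ring.
rewrite -telescope_sumr // big_mkord; apply: eq_bigr => i _.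
rewrite lambert_shift_diff; congr (_ * (1 - _)); apply/esym.
by apply: big_nat_trunc u1; lia.
Qed.

End LambertTelescope.

(** * q-series at a nilpotent q *)

Lemma nilp_expr0 (R : pzSemiRingType) (x : R) N k :
  x ^+ N = 0 -> (N <= k)%N -> x ^+ k = 0.
Proof. by move=> xN0 leNk; rewrite -(subnK leNk) exprD xN0 mulr0. Qed.

Lemma nilp_order_gt0 (R : nzSemiRingType) (x : R) N : x ^+ N = 0 -> (0 < N)%N.
Proof. by case: N => // /eqP; rewrite expr0 oner_eq0. Qed.

Definition geom (R : pzSemiRingType) (N : nat) (x : R) : R :=
  \sum_(i < N) x ^+ i.

Lemma geomP (R : pzRingType) N (x : R) : x ^+ N = 0 -> (1 - x) * geom N x = 1.
Proof. by move=> xN0; rewrite /geom -opprB mulNr -subrX1 xN0 sub0r opprK. Qed.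

Lemma sum_expr_leq (R : pzSemiRingType) (x : R) N d : x ^+ N = 0 ->
  \sum_(c < N | (c <= d)%N) x ^+ c = \sum_(c < d.+1) x ^+ c.
Proof.
move=> xN0; pose F c := if (c <= d)%N then x ^+ c else 0.
rewrite big_mkcond -/F -(@big_ord_trunc _ _ _ N (N + d.+1) F) ?leq_addr //.
  rewrite (@big_ord_trunc _ _ _ d.+1 _ F) ?leq_addl //.
    by apply: eq_bigr => c _; rewrite /F -ltnS ltn_ord.
  by move=> c lt_dc; rewrite /F leqNgt lt_dc.
by move=> c leNc; rewrite /F (nilp_expr0 xN0) // if_same.
Qed.

Lemma sum_expr_gt0 (R : nzRingType) N (x : R) : x ^+ N = 0 ->
  \sum_(c < N | (0 < c)%N) x ^+ c = x * geom N x.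
Proof.
move=> xN0; have N_gt0 := nilp_order_gt0 xN0.
have geom_eq : 1 + x * geom N x = geom N x.
  by rewrite -{1}(geomP xN0) mulrBl mul1r subrK.
apply: (@addrI _ 1).
rewrite geom_eq /geom [RHS](bigD1 (Ordinal N_gt0)) //= expr0.
by congr (_ + _); apply: eq_bigl => c; rewrite -val_eqE lt0n.
Qed.

Lemma eq_geom_mul (R : comPzRingType) N (x s t : R) :
  x ^+ N = 0 -> s = t + x * s -> s = geom N x * t.
Proof.
move=> xN0 s_eq; have -> : t = (1 - x) * s.
  by rewrite mulrBl mul1r [X in X - _]s_eq addrK.
by rewrite mulrCA mulrA geomP // mul1r.
Qed.

Section QBinomialSeries.

Variables (R : comNzRingType) (x z : R) (N : nat).
Hypothesis zN0 : z ^+ N = 0.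

Let zxN0 m : (z * x ^+ m) ^+ N = 0.
Proof. by rewrite exprMn zN0 mul0r. Qed.

Lemma sum_qmultichoose_rec (w : nat -> nat) m :
  \sum_(r < N) z ^+ r * qmultichoose x m.+1 r *+ w r =
  \sum_(r < N) z ^+ r * qmultichoose x m r *+ w r +
    z * x ^+ m * \sum_(r < N) z ^+ r * qmultichoose x m.+1 r *+ w r.+1.
Proof.
case: N zN0 => [|n] zn0; first by rewrite !big_ord0 mulr0 addr0.
rewrite [LHS]big_ord_recl [in RHS]big_ord_recl /= !qmultichoosen0 -addrA.
congr (_ + _); rewrite mulr_sumr [in RHS]big_ord_recr /=.
have -> : z * x ^+ m * (z ^+ n * qmultichoose x m.+1 n *+ w n.+1) = 0.
  by rewrite mulrnAr mulrACA -exprS zn0 !mul0r mul0rn.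
rewrite addr0 -big_split; apply: eq_bigr => r _ /=.
rewrite /bump add1n qmultichooseSS mulrDr mulrnDl mulrnAr exprS.
by congr (_ + _ *+ _); ring.
Qed.

Lemma sum_qmultichoose m :
  \sum_(r < N) z ^+ r * qmultichoose x m r = \prod_(s < m) geom N (z * x ^+ s).
Proof.
elim: m => [|m IHm].
  rewrite big_ord0 -(prednK (nilp_order_gt0 zN0)) big_ord_recl big1 ?addr0 /=.
    by rewrite expr0 mul1r.
  by move=> r _; rewrite qmultichoose0n mulr0.
rewrite big_ord_recr /= -IHm mulrC; apply: eq_geom_mul; first exact: zxN0.
exact: (sum_qmultichoose_rec (fun=> 1%N)).
Qed.

(* The image of [sum_qmultichoose] under z d/dz. *)
Lemma sum_qmultichoose_mulrn m :
  \sum_(r < N) z ^+ r * qmultichoose x m r *+ r =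
  \prod_(s < m) geom N (z * x ^+ s) *
    \sum_(s < m) z * x ^+ s * geom N (z * x ^+ s).
Proof.
elim: m => [|m IHm].
  by rewrite !big_ord0 mulr0 big1 // => -[[|r] ltr] _ //=; rewrite mulr0 mul0rn.
rewrite [in RHS]big_ord_recr [X in _ * X]big_ord_recr /= -mulrA mulrCA.
set P := \prod_(s < m) _ in IHm *; set S := \sum_(s < m) _ in IHm *.
set y := z * x ^+ m; set G := geom N y.
rewrite [P * _](_ : _ = P * S + y * (P * G)); last by ring.
apply: eq_geom_mul; first exact: zxN0.
rewrite [LHS](sum_qmultichoose_rec id) IHm -addrA; congr (_ + _).
have <- : \sum_(r < N) z ^+ r * qmultichoose x m.+1 r = P * G.
  by rewrite sum_qmultichoose big_ord_recr.
rewrite -mulrDr -big_split; congr (_ * _); apply: eq_bigr => r _.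
by rewrite /= mulrS.
Qed.

End QBinomialSeries.

Section NilpotentQSeries.

Variables (R : comNzRingType) (N : nat) (q : R).
Hypothesis qN0 : q ^+ N = 0.

(* 1 / (1 - q ^+ k) and 1 / (1 + q ^+ k), for 0 < k. *)
Definition inv_subX k := geom N (q ^+ k).
Definition inv_addX k := geom N (- q ^+ k).

Let qXN0 k : (0 < k)%N -> (q ^+ k) ^+ N = 0.
Proof. by move=> k0; rewrite -exprM (nilp_expr0 qN0) // leq_pmull. Qed.

Lemma inv_subXP k : (0 < k)%N -> (1 - q ^+ k) * inv_subX k = 1.
Proof. by move=> k0; rewrite geomP ?qXN0. Qed.

Lemma inv_addXP k : (0 < k)%N -> (1 + q ^+ k) * inv_addX k = 1.
Proof.
by move=> k0; rewrite -[X in 1 + X]opprK geomP // exprNn qXN0 ?mulr0.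
Qed.

Lemma inv_subX_double k :
  (0 < k)%N -> inv_subX (2 * k) = inv_subX k * inv_addX k.
Proof.
move=> k0; have := inv_subXP k0; have := inv_addXP k0.
have := @inv_subXP (2 * k); rewrite muln_gt0 k0 mulnC exprM => /(_ isT).
move: (inv_subX k) (inv_addX k) (inv_subX (k * 2)) (q ^+ k) => i j d y dP jP iP.
transitivity ((1 - y) * i * ((1 + y) * j) * d); first by rewrite iP jP !mul1r.
by transitivity (i * j * ((1 - y ^+ 2) * d)); [ring | rewrite dP mulr1].
Qed.

(* In Pochhammer notation: (q; q^2)_m, 1 / (q; q^2)_m, (-q; q)_m and
   1 / (-q; q)_m. *)
Definition odd_poch m := \prod_(s < m) (1 - q ^+ (2 * s).+1).
Definition inv_odd_poch m := \prod_(s < m) inv_subX (2 * s).+1.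
Definition neg_poch m := \prod_(s < m) (1 + q ^+ s.+1).
Definition inv_neg_poch m := \prod_(s < m) inv_addX s.+1.

Definition lambert := \sum_(k < N) q ^+ k.+1 * inv_subX k.+1.
Definition even_lambert := \sum_(m < N) q ^+ (2 * m.+1) * inv_subX (2 * m.+1).
Definition odd_lambert := \sum_(m < N) q ^+ (2 * m).+1 * inv_subX (2 * m).+1.
Definition alt_lambert := \sum_(k < N) q ^+ k.+1 * inv_addX k.+1.

Lemma odd_pochK m : odd_poch m * inv_odd_poch m = 1.
Proof. by rewrite -big_split big1 // => s _; rewrite /= inv_subXP. Qed.

Lemma neg_pochK m : neg_poch m * inv_neg_poch m = 1.
Proof. by rewrite -big_split big1 // => s _; rewrite /= inv_addXP. Qed.

Lemma expr_odd s : q * (q ^+ 2) ^+ s = q ^+ (2 * s).+1.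
Proof. by rewrite -exprM -exprS. Qed.

Lemma inv_odd_pochE m :
  inv_odd_poch m = \sum_(r < N) q ^+ r * qmultichoose (q ^+ 2) m r.
Proof.
by rewrite sum_qmultichoose //; apply: eq_bigr => s _; rewrite expr_odd.
Qed.

Lemma qmultichoose_stable r m1 m2 : (0 < m1)%N -> (0 < m2)%N ->
    (N <= r + m1)%N -> (N <= r + m2)%N ->
  q ^+ r * qmultichoose (q ^+ 2) m1 r = q ^+ r * qmultichoose (q ^+ 2) m2 r.
Proof.
wlog le_m : m1 m2 / (m1 <= m2)%N.
  move=> stable m1_gt0 m2_gt0 leN1 leN2.
  by have [/stable->|/ltnW/stable->] := leqP m1 m2.
move=> m1_gt0 _ leN1 _; rewrite -(subnK le_m).
elim: (m2 - m1)%N => // k ->; rewrite addSn; case: r leN1 => [|r] leN1.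
  by rewrite !qmultichoosen0.
rewrite qmultichooseSS mulrDr mulrA -exprM -exprD.
by rewrite [q ^+ (_ + _)](nilp_expr0 qN0) ?mul0r ?addr0 //; lia.
Qed.

(* Euler's theorem on partitions into distinct parts and into odd parts. *)
Lemma neg_poch_inv_odd_poch : neg_poch N = inv_odd_poch N.
Proof.
have N_gt0 := nilp_order_gt0 qN0.
rewrite /neg_poch -sum_qmultichoose_antidiag inv_odd_pochE big_ord_recr /=.
rewrite qN0 mul0r addr0; apply: eq_bigr => r _.
by apply: qmultichoose_stable; lia.
Qed.

Lemma odd_poch_inv_neg_poch : odd_poch N = inv_neg_poch N.
Proof.
rewrite -[LHS]mulr1 -(neg_pochK N) neg_poch_inv_odd_poch mulrA odd_pochK.
by rewrite mul1r.
Qed.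

(* Compared with the common limit, the sum over i weighs the partitions into
   distinct parts by their largest part and those into odd parts, negatively, by
   (largest - 1) / 2; by Fine's refinement the difference is the number of odd
   parts. *)
Lemma sum_inv_odd_poch_sub_neg_poch :
  \sum_(i < N) (inv_odd_poch i.+1 - neg_poch i) = inv_odd_poch N * odd_lambert.
Proof.
pose h r m := q ^+ r * qmultichoose (q ^+ 2) m r.
transitivity (\sum_(r < N) h r N *+ r); last first.
  rewrite sum_qmultichoose_mulrn //.
  by congr (_ * _); apply: eq_bigr => s _; rewrite expr_odd.
have sum_odd : \sum_(i < N) inv_odd_poch i.+1 =
    \sum_(r < N) \sum_(j < N) h r j.+1.
  by rewrite exchange_big; apply: eq_bigr => i _; apply: inv_odd_pochE.
have sum_neg : \sum_(i < N) neg_poch i =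
    \sum_(r < N) \sum_(j < N - r) h r j.+1.
  rewrite -(sum_antidiag N (fun r j => h r j.+1)); apply: eq_bigr => i _.
  by rewrite /neg_poch -sum_qmultichoose_antidiag.
rewrite sumrB sum_odd sum_neg -sumrB; apply: eq_bigr => r _.
rewrite -!(big_mkord xpredT (fun j => h r j.+1)).
rewrite (big_cat_nat (leq0n (N - r)) (leq_subr r N)) /= addrAC subrr add0r.
rewrite (eq_big_nat _ _ (F2 := fun=> h r N)); last first.
  by move=> j leNj; apply: qmultichoose_stable; lia.
by rewrite sumr_const_nat subKn // ltnW.
Qed.

Definition lambert_inv_neg_poch :=
  \sum_(m < N) q ^+ m.+1 * inv_subX m.+1 * inv_neg_poch m.+1.
Definition lambert_odd_poch :=
  \sum_(m < N) q ^+ (2 * m.+1) * inv_subX (2 * m.+1) * odd_poch m.+1.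

Lemma lambert_inv_neg_pochE :
  lambert_inv_neg_poch = lambert + alt_lambert -
    \sum_(i < N) (1 - inv_neg_poch N * neg_poch i).
Proof.
have inv_subP m := inv_subXP (ltn0Sn m).
have vP s : (1 - (- 1) * (q * q ^+ s)) * inv_addX s.+1 = 1.
  by rewrite -exprS mulN1r opprK inv_addXP.
have uE s : inv_addX s.+1 = (1 - 0 * (q * q ^+ s)) * inv_addX s.+1.
  by rewrite mul0r subr0 mul1r.
rewrite [LHS](lambert_telescope inv_subP vP uE (leqnn N)); last first.
  by move=> s leNs; rewrite -exprS (nilp_expr0 qN0) // leqW.
rewrite -addrA; congr (_ + _); rewrite -sumrN -sumrB; apply: eq_bigr => i _.
have invK s : inv_addX s.+1 * (1 + q ^+ s.+1) = 1 by rewrite mulrC inv_addXP.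
rewrite -(prod_inv_tail (ltnW (ltn_ord i)) invK).
rewrite [in RHS]big_ltn // -[X in _ = _ - (X - _)](inv_addXP (ltn0Sn i)); ring.
Qed.

Lemma lambert_odd_pochE :
  lambert_odd_poch =
  even_lambert - \sum_(i < N) (1 - odd_poch N * inv_odd_poch i.+1).
Proof.
have inv_subP m : (1 - (q ^+ 2) ^+ m.+1) * inv_subX (2 * m.+1) = 1.
  by rewrite -exprM inv_subXP.
have vP s : (1 - 0 * (q * (q ^+ 2) ^+ s)) * 1 = 1 by rewrite mul0r subr0 mulr1.
have uE s : 1 - q ^+ (2 * s).+1 = (1 - 1 * (q * (q ^+ 2) ^+ s)) * 1.
  by rewrite expr_odd mul1r mulr1.
have invK s := inv_subXP (ltn0Sn (2 * s)).
transitivity (\sum_(m < N)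
    (q ^+ 2) ^+ m.+1 * inv_subX (2 * m.+1) * odd_poch m.+1).
  by apply: eq_bigr => m _; rewrite exprM.
rewrite (lambert_telescope inv_subP vP uE (leqnn N)); last first.
  by move=> s leNs; rewrite expr_odd (nilp_expr0 qN0) //; lia.
congr (_ - _); apply: eq_bigr => i _; first by rewrite exprM.
by rewrite mul1r -(prod_inv_tail (ltn_ord i) invK).
Qed.

Lemma lambert_parity : lambert = even_lambert + odd_lambert.
Proof.
pose a k := q ^+ k.+1 * inv_subX k.+1.
have a0 k : (N <= k)%N -> a k = 0.
  by move=> leNk; rewrite /a (nilp_expr0 qN0) ?mul0r ?leqW.
have leN2N : (N <= 2 * N)%N by rewrite leq_pmull.
rewrite -[LHS](big_ord_trunc _ leN2N a0) big_ord_double big_split [RHS]addrC /=.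
by congr (_ + _); apply: eq_bigr => m _; rewrite mulnS.
Qed.

Lemma lambert_inv_neg_poch_sub_odd_poch :
  lambert_inv_neg_poch - lambert_odd_poch = alt_lambert.
Proof.
rewrite lambert_inv_neg_pochE lambert_odd_pochE lambert_parity.
have -> : \sum_(i < N) (1 - inv_neg_poch N * neg_poch i) =
    \sum_(i < N) (1 - odd_poch N * inv_odd_poch i.+1) + odd_lambert.
  rewrite -[odd_lambert]mul1r -[X in X * odd_lambert](odd_pochK N) -mulrA.
  rewrite -sum_inv_odd_poch_sub_neg_poch mulr_sumr -big_split.
  by apply: eq_bigr => i _ /=; rewrite odd_poch_inv_neg_poch; ring.
ring.
Qed.

Definition p1_series :=
  \sum_(m < N) q ^+ (2 * m.+1) * inv_subX (2 * m.+1) * odd_poch m.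
Definition p2_series :=
  \sum_(m < N) q ^+ (2 * m.+1) * inv_subX (2 * m.+1) * inv_neg_poch m.

Lemma p1_series_lambert :
  (1 - q) * p1_series + q * lambert_odd_poch = q * (1 - odd_poch N).
Proof.
have -> : 1 - odd_poch N = \sum_(0 <= m < N) (- odd_poch m.+1 - - odd_poch m).
  by rewrite telescope_sumr // [odd_poch 0]big_ord0 opprK addrC.
rewrite big_mkord !mulr_sumr -big_split; apply: eq_bigr => m _ /=.
have odd_pochS : odd_poch m.+1 = odd_poch m * (1 - q ^+ (2 * m).+1).
  by rewrite /odd_poch big_ord_recr.
have even_exprE : q ^+ (2 * m.+1) = q * q ^+ (2 * m).+1 by rewrite -exprS mulnS.
have := @inv_subXP (2 * m.+1) isT; rewrite odd_pochS even_exprE.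
move: (q ^+ (2 * m).+1) (inv_subX _) => x j jP.
transitivity ((1 - q * x) * j * (q * x * odd_poch m)); first by ring.
by rewrite jP; ring.
Qed.

Lemma p2_series_lambert :
  p2_series + (1 - inv_neg_poch N) = lambert_inv_neg_poch.
Proof.
have -> : 1 - inv_neg_poch N =
    \sum_(0 <= m < N) (- inv_neg_poch m.+1 - - inv_neg_poch m).
  by rewrite telescope_sumr // [inv_neg_poch 0]big_ord0 opprK addrC.
rewrite big_mkord -big_split; apply: eq_bigr => m _ /=.
have inv_neg_pochS : inv_neg_poch m.+1 = inv_neg_poch m * inv_addX m.+1.
  by rewrite /inv_neg_poch big_ord_recr.
have := inv_subXP (ltn0Sn m); have := inv_addXP (ltn0Sn m).
rewrite inv_neg_pochS inv_subX_double // mulnC exprM.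
move: (inv_neg_poch m) (inv_subX _) (inv_addX _) (q ^+ _) => p i j x jP iP.
transitivity (x ^+ 2 * (i * j) * p + ((1 + x) * j - j) * p).
  by rewrite jP; ring.
transitivity (x ^+ 2 * (i * j) * p + x * p * j * ((1 - x) * i)); last by ring.
by rewrite iP; ring.
Qed.

Lemma p1_series_p2_series :
  (1 - q) * p1_series + q * p2_series = q * alt_lambert.
Proof.
rewrite -lambert_inv_neg_poch_sub_odd_poch -p2_series_lambert.
rewrite -odd_poch_inv_neg_poch.
transitivity ((1 - q) * p1_series + q * lambert_odd_poch +
              q * (p2_series - lambert_odd_poch)); first by ring.
by rewrite p1_series_lambert; ring.
Qed.

End NilpotentQSeries.

(** * Partitions given by their multiplicities *)

Lemma leq_largest s k : k \in s -> (k <= largest s)%N.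
Proof. by move=> ks; apply: (@leq_bigmax_seq _ _ xpredT id). Qed.

Lemma partition_bounds n s :
  is_partition n s -> all (fun k => 0 < k <= n)%N s.
Proof.
case/and3P=> _ s0 /eqP <-; apply/allP => k ks; rewrite leq_mem_sumn // andbT.
by rewrite lt0n; apply: contraNneq s0 => <-.
Qed.

Lemma largest_partition_leq n s : is_partition n s -> (largest s <= n)%N.
Proof.
move=> /partition_bounds/allP bounds_s; apply/bigmax_leqP_seq => k ks _.
by case/andP: (bounds_s k ks).
Qed.

Lemma largest_partition_gt0 n s :
  is_partition n s -> (0 < n)%N -> (0 < largest s)%N.
Proof.
move=> ps n_gt0; have bounds_s := partition_bounds ps.
case: s ps bounds_s => [|k s] ps; first by case/and3P: ps n_gt0 => _ _ /eqP <-.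
by case/andP=> /andP[k_gt0 _] _; apply: leq_trans (leq_largest (mem_head k s)).
Qed.

Lemma largest_eq s t : (0 < t)%N ->
  (largest s == t) = (t \in s) && all (leq^~ t) s.
Proof.
move=> t_gt0; apply/eqP/andP => [eq_t|[ts /allP le_t]]; last first.
  apply/eqP; rewrite eqn_leq leq_largest // andbT.
  by apply/bigmax_leqP_seq => k /le_t.
have le_t k : k \in s -> (k <= t)%N.
  by rewrite -eq_t; apply: leq_largest.
split; last exact/allP.
apply: contraTT t_gt0 => tNs; suff: (largest s <= t.-1)%N by lia.
apply/bigmax_leqP_seq => k ks _; have := le_t k ks.
by rewrite leq_eqVlt; case: eqP => [k_eq|_ /=]; [rewrite -k_eq ks in tNs | lia].
Qed.

Lemma sum_partitions_largest (V : nmodType) (F : seq nat -> V) (Q : pred nat)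
    (P : nat -> pred (seq nat)) n N : (0 < n < N)%N ->
  \sum_(s <- partitions n | Q (largest s) && P (largest s) s) F s =
  \sum_(t < N | Q t.+1)
    \sum_(s <- partitions n | (largest s == t.+1) && P t.+1 s) F s.
Proof.
move=> /andP[n_gt0 lt_nN].
rewrite [RHS](exchange_big_dep xpredT) //= big_mkcond /=.
apply: eq_big_seq => s; rewrite mem_partitions => ps.
have L_gt0 := largest_partition_gt0 ps n_gt0.
have L_lt : ((largest s).-1 < N)%N by have := largest_partition_leq ps; lia.
rewrite big_mkcond (bigD1 (Ordinal L_lt)) //= big1 => [|t ne_t]; last first.
  case: ifP => // /and3P[_ /eqP Lt _]; case/eqP: ne_t; apply: val_inj.
  by rewrite /= Lt.
by rewrite prednK // eqxx addr0.
Qed.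

Section Multiplicities.

Variable N : nat.
Implicit Types (f : {ffun 'I_N -> 'I_N}) (s : seq nat).

Definition parts_of f : seq nat :=
  sort geq (flatten [seq nseq (f k) k.+1 | k <- enum 'I_N]).

Lemma count_parts_of (a : pred nat) f :
  count a (parts_of f) = (\sum_(k < N) a k.+1 * f k)%N.
Proof.
rewrite (permP (permEl (perm_sort geq _))) count_flatten -map_comp.
rewrite sumnE big_map big_enum; apply: eq_bigr => k _; exact: count_nseq.
Qed.

Lemma count_mem_parts_of f (k : 'I_N) : count_mem k.+1 (parts_of f) = f k.
Proof.
rewrite count_parts_of (bigD1 k) //= eqxx mul1n big1 ?addn0 // => j jk.
by rewrite eqSS (negbTE (jk : val j != val k)).
Qed.

Lemma mem_parts_of f (k : 'I_N) : (k.+1 \in parts_of f) = (0 < f k)%N.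
Proof. by rewrite -has_pred1 has_count count_mem_parts_of. Qed.

Lemma all_parts_of (a : pred nat) f :
  all a (parts_of f) = [forall k, (0 < f k)%N ==> a k.+1].
Proof.
rewrite (eq_all_r (perm_mem (permEl (perm_sort geq _)))).
apply/allP/forallP => [all_a k|all_a x].
  apply/implyP => fk_gt0; apply: all_a; apply/flatten_mapP.
  by exists k; rewrite ?mem_enum // mem_nseq fk_gt0 eqxx.
case/flatten_mapP => k _; rewrite mem_nseq => /andP[fk_gt0 /eqP ->].
exact: implyP (all_a k) fk_gt0.
Qed.

Lemma sumn_parts_of f : sumn (parts_of f) = (\sum_(k < N) k.+1 * f k)%N.
Proof.
rewrite (perm_sumn (permEl (perm_sort geq _))) sumn_flatten -map_comp.
rewrite sumnE big_map big_enum; apply: eq_bigr => k _; exact: sumn_nseq.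
Qed.

Lemma parts_of_partition f : is_partition (sumn (parts_of f)) (parts_of f).
Proof.
apply/and3P; split=> //; first by apply: sort_sorted => a b; apply: leq_total.
have /allP gt0 : all (leq 1) (parts_of f).
  by rewrite all_parts_of; apply/forallP => k; rewrite implybT.
by apply/negP => /gt0.
Qed.

Lemma parts_of_inj : injective parts_of.
Proof.
move=> f g eq_fg; apply/ffunP => k; apply: val_inj.
by rewrite /= -!count_mem_parts_of eq_fg.
Qed.

Lemma partition_parts_of n s :
  is_partition n s -> (n < N)%N -> exists f, s = parts_of f.
Proof.
move=> ps ltnN; have /allP bounds_s := partition_bounds ps.
have [sorted_s s0 /eqP sum_s] := and3P ps.
have lt_count k : (count_mem k s < N)%N.
  rewrite (leq_ltn_trans (count_size _ _)) //.
  by rewrite (leq_ltn_trans (size_leq_sumn s0)) ?sum_s.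
pose f := [ffun k : 'I_N => Ordinal (lt_count k.+1)].
have /allP bounds_f : all (fun k => 0 < k <= N)%N (parts_of f).
  by rewrite all_parts_of; apply/forallP => k; rewrite ltn_ord implybT.
exists f; apply: (sorted_eq (leT := geq)) => //.
- by move=> a b c /= ab bc; apply: leq_trans bc ab.
- by move=> a b /= /andP[ab ba]; apply/eqP; rewrite eqn_leq ab ba.
- by apply: sort_sorted => a b; apply: leq_total.
apply/allP => x; rewrite mem_cat => x_in; apply/eqP.
have /andP[x_gt0 le_xN] : (0 < x <= N)%N.
  by case/orP: x_in => [/bounds_s|/bounds_f //]; lia.
have ltxN : (x.-1 < N)%N by rewrite prednK.
by have := count_mem_parts_of f (Ordinal ltxN); rewrite ffunE /= prednK.
Qed.

Lemma sum_partitions (V : nmodType) (F : seq nat -> V) n : (n < N)%N ->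
  \sum_(s <- partitions n) F s =
  \sum_(f | sumn (parts_of f) == n) F (parts_of f).
Proof.
move=> ltnN.
rewrite -[RHS]big_filter -(big_map parts_of xpredT F); apply: perm_big.
apply: uniq_perm; rewrite ?partitions_uniq //.
  by rewrite (map_inj_uniq parts_of_inj) filter_uniq // index_enum_uniq.
move=> s; rewrite mem_partitions; apply/idP/mapP => [ps|[f + ->]]; last first.
  by rewrite mem_filter => /andP[/eqP <- _]; apply: parts_of_partition.
have [f s_eq] := partition_parts_of ps ltnN; exists f => //.
by rewrite mem_filter mem_index_enum andbT -s_eq; case/and3P: ps.
Qed.

Lemma partitions_gf (R : pzSemiRingType) (q : R) (F : seq nat -> R) :
    q ^+ N = 0 ->
  \sum_(n < N) (\sum_(s <- partitions n) F s) * q ^+ n =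
  \sum_f F (parts_of f) * q ^+ sumn (parts_of f).
Proof.
move=> qN0; transitivity (\sum_f \sum_(n < N | sumn (parts_of f) == n)
    F (parts_of f) * q ^+ sumn (parts_of f)).
  rewrite (exchange_big_dep xpredT) //=; apply: eq_bigr => n _.
  by rewrite sum_partitions // mulr_suml; apply: eq_bigr => f /eqP ->.
apply: eq_bigr => f _; have [ltfN|leNf] := ltnP (sumn (parts_of f)) N.
  by rewrite (big_pred1 (Ordinal ltfN)) // => n; rewrite /= eq_sym.
by rewrite big1 (nilp_expr0 qN0 leNf) mulr0.
Qed.

End Multiplicities.

(** * Generating functions by largest part *)

Definition mults_allowed (allowed : nat -> nat -> bool) (t : nat)
    (s : seq nat) : bool :=
  all (fun k => (k < t)%N ==> allowed k (count_mem k s)) s.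

Section LargestPart.

Variables (R : comNzRingType) (q : R) (N : nat) (t : 'I_N).
Variable allowed : nat -> nat -> bool.
Hypothesis qN0 : q ^+ N = 0.
Hypothesis allowed0 : forall k, allowed k 0%N.

Definition largest_allowed (k c : 'I_N) : bool :=
  if (k < t)%N then allowed k.+1 c else (0 < c)%N == (k == t).

Lemma largest_parts_of (f : {ffun 'I_N -> 'I_N}) :
  (largest (parts_of f) == t.+1) && mults_allowed allowed t.+1 (parts_of f) =
  [forall k, largest_allowed k (f k)].
Proof.
rewrite largest_eq // mem_parts_of /mults_allowed !all_parts_of -andbA.
rewrite /largest_allowed.
apply/and3P/forallP => [[ft_gt0 /forallP le_t /forallP allowed_f] k|ok_f].
  have := le_t k; have := allowed_f k; rewrite count_mem_parts_of /= ltnS.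
  have [lt_kt|le_tk] := ltnP k t; first by case: posnP => [->|].
  have [->|ne_kt] := eqVneq k t; first by rewrite ft_gt0.
  by move=> _; case: posnP => //= _; move: ne_kt; rewrite -val_eqE /=; lia.
split.
- by have := ok_f t; rewrite ltnn eqxx => /eqP.
- apply/forallP => k; apply/implyP => fk_gt0; have := ok_f k; rewrite fk_gt0.
  by have [/ltnW//|_ /eqP/esym/eqP ->] := ltnP k t.
- apply/forallP => k; apply/implyP => _; apply/implyP => lt_kt.
  by rewrite count_mem_parts_of; have := ok_f k; rewrite ifT.
Qed.

(* The contribution of c copies of k.+1 when t.+1 is the largest part. *)
Definition largest_term (k c : 'I_N) : R :=
  if largest_allowed k c then (-1) ^+ ((k < t)%N * c) * q ^+ (k.+1 * c) else 0.

Lemma sum_largest_term_lt (k : 'I_N) : (k < t)%N ->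
  \sum_c largest_term k c = \sum_(c < N | allowed k.+1 c) (- q ^+ k.+1) ^+ c.
Proof.
move=> lt_kt; rewrite [RHS]big_mkcond; apply: eq_bigr => c _.
by rewrite /largest_term /largest_allowed lt_kt mul1n [in RHS]exprNn -exprM.
Qed.

Lemma sum_largest_term_eq :
  \sum_c largest_term t c = q ^+ t.+1 * inv_subX N q t.+1.
Proof.
rewrite /inv_subX -sum_expr_gt0; last first.
  by rewrite -exprM (nilp_expr0 qN0) // leq_pmull.
rewrite [RHS]big_mkcond; apply: eq_bigr => c _.
by rewrite /largest_term /largest_allowed ltnn eqxx eqb_id expr0 mul1r -exprM.
Qed.

Lemma sum_largest_term_gt (k : 'I_N) : (t < k)%N -> \sum_c largest_term k c = 1.
Proof.
move=> lt_tk; rewrite (bigD1 (Ordinal (nilp_order_gt0 qN0))) //=.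
rewrite /largest_term /largest_allowed.
have [-> ->] : (k < t)%N = false /\ (k == t) = false.
  by rewrite -val_eqE /=; lia.
rewrite /= !muln0 mulr1 big1 ?addr0 // => c.
by rewrite -val_eqE /= -lt0n => ->.
Qed.

Lemma prod_largest_term (f : {ffun 'I_N -> 'I_N}) :
  \prod_k largest_term k (f k) =
  (if (largest (parts_of f) == t.+1) && mults_allowed allowed t.+1 (parts_of f)
   then (-1) ^+ count (leq^~ t) (parts_of f) else 0) * q ^+ sumn (parts_of f).
Proof.
rewrite prod_if0 largest_parts_of //; case: ifP => _; rewrite ?mul0r //.
by rewrite count_parts_of sumn_parts_of -!prodrXr -big_split.
Qed.

Lemma largest_part_gf :
  \sum_(n < N) (\sum_(s <- partitions n |
      (largest s == t.+1) && mults_allowed allowed t.+1 s)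
    (-1) ^+ count (leq^~ t) s) * q ^+ n =
  q ^+ t.+1 * inv_subX N q t.+1 *
    \prod_(k < t) \sum_(c < N | allowed k.+1 c) (- q ^+ k.+1) ^+ c.
Proof.
under eq_bigr => n _ do rewrite big_mkcond.
rewrite partitions_gf // -(eq_bigr _ (fun f _ => prod_largest_term f)).
rewrite -(bigA_distr_bigA largest_term) (bigD1 t) //= sum_largest_term_eq.
congr (_ * _); rewrite (bigID (fun k : 'I_N => (k < t)%N)) /=.
rewrite [X in _ * X]big1 ?mulr1 => [|k /andP[ne_kt ge_kt]]; last first.
  by apply: sum_largest_term_gt; move: ne_kt; rewrite -val_eqE /=; lia.
rewrite (big_ord_widen_cond N xpredT
  (fun k => \sum_(c < N | allowed k.+1 c) (- q ^+ k.+1) ^+ c)) 1?ltnW //=.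
apply: eq_big => [k|k /andP[_ lt_kt]]; last exact: sum_largest_term_lt.
by rewrite -val_eqE /=; lia.
Qed.

End LargestPart.

Definition mult_admissible (allowed : nat -> nat -> nat -> bool)
    (s : seq nat) : bool :=
  ~~ odd (largest s) && mults_allowed (allowed (largest s)) (largest s) s.

Definition signed_count (P : pred (seq nat)) (n : nat) : int :=
  \sum_(s <- partitions n | P s) (-1) ^+ count (fun k => k < largest s)%N s.

Definition p1_allowed (t k c : nat) : bool := (c <= (odd k && (k != t - 1)))%N.

Definition p2_allowed (t k c : nat) : bool := (c == 0%N) || (k < t./2)%N.

Lemma p1_admissibleE s : p1_admissible s = mult_admissible p1_allowed s.
Proof.
rewrite /p1_admissible /mult_admissible /mults_allowed; congr (_ && _).
set small := [seq k <- s | (k < largest s)%N]; rewrite -all_filter -/small.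
have count_small k : k \in small -> count_mem k small = count_mem k s.
  rewrite mem_filter => /andP[lt_k _]; rewrite count_filter.
  by apply: eq_count => x /=; case: eqP => // ->.
apply/andP/allP => [[uniq_small /allP ok] k k_small|ok].
  by rewrite /p1_allowed ok // -count_small // count_uniq_mem // k_small.
split; last first.
  apply/allP => k k_small; have := ok k k_small; rewrite /p1_allowed leqNgt.
  apply: contraNT => /negbTE ->; rewrite -has_count has_pred1.
  by move: k_small; rewrite mem_filter => /andP[].
apply: count_mem_uniq => k.
have [k_small|/count_memPn//] := boolP (k \in small).
apply/eqP; rewrite eqn_leq -[(0 < _)%N]has_count has_pred1 k_small andbT.
by rewrite count_small // (leq_trans (ok k k_small)) // leq_b1.
Qed.

Lemma p2_admissibleE s :
  0%N \notin s -> p2_admissible s = mult_admissible p2_allowed s.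
Proof.
move=> s0; rewrite /p2_admissible /mult_admissible /mults_allowed.
case: (boolP (odd (largest s))) => //= even_L; apply: eq_in_all => k ks.
have k_gt0 : (0 < k)%N by case: k ks (s0) => // ->.
have le_kL := leq_largest ks.
have : (0 < count_mem k s)%N by rewrite -has_count has_pred1.
rewrite /p2_allowed lt0n => /negbTE ->; move: le_kL even_L.
by move: (largest s) => L; lia.
Qed.

Lemma p1E n : p1 n = signed_count (mult_admissible p1_allowed) n.
Proof.
rewrite /signed_count -(eq_bigl _ _ p1_admissibleE); apply: eq_bigr => s.
case/and3P => even_L _ /allP ok; congr (_ ^+ _); apply: eq_in_count => k ks.
have le_kL := leq_largest ks.
have [lt_kL|le_Lk] := ltnP k (largest s).
  by have := ok k; rewrite mem_filter lt_kL ks => /(_ isT)/andP[].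
by rewrite (_ : k = largest s) ?(negbTE even_L) //; lia.
Qed.

Lemma p2E n : p2 n = signed_count (mult_admissible p2_allowed) n.
Proof.
rewrite /p2 /signed_count big_mkcond [RHS]big_mkcond; apply: eq_big_seq => s.
rewrite mem_partitions => /and3P[_ s0 _]; rewrite p2_admissibleE //.
case: ifP => // _; congr (_ ^+ _).
pose small k := (k < largest s)%N; rewrite -(count_predC small s) /largest_mult.
rewrite (@eq_in_count _ (pred1 (largest s)) (predC small)) ?addnK // => k ks.
by rewrite /= /small; have := leq_largest ks; lia.
Qed.

Lemma prod_p1_allowed m N (R : comNzRingType) (q : R) : q ^+ N = 0 ->
  \prod_(k < (2 * m).+1)
    \sum_(c < N | p1_allowed (2 * m.+1)%N k.+1 c) (- q ^+ k.+1) ^+ c =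
  odd_poch q m.
Proof.
move=> qN0.
pose F k := if odd k.+1 && (k.+1 != (2 * m).+1) then 1 - q ^+ k.+1 else 1.
transitivity (\prod_(k < (2 * m).+1) F k).
  apply: eq_bigr => k _; rewrite /p1_allowed mulnS subSS subn0.
  rewrite sum_expr_leq; last first.
    by rewrite exprNn -exprM (nilp_expr0 qN0) ?mulr0 ?leq_pmull.
  by rewrite /F; case: (_ && _); rewrite ?big_ord_recr big_ord0 /= ?add0r.
rewrite big_ord_recr /= {2}/F eqxx andbF mulr1 big_ord_double.
apply: eq_bigr => s _; rewrite /F /= mul2n odd_double /= mulr1 -mul2n ifT //.
by have := ltn_ord s; lia.
Qed.

Lemma prod_p2_allowed m N (R : comNzRingType) (q : R) : q ^+ N = 0 ->
  \prod_(k < (2 * m).+1)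
    \sum_(c < N | p2_allowed (2 * m.+1)%N k.+1 c) (- q ^+ k.+1) ^+ c =
  inv_neg_poch N q m.
Proof.
move=> qN0; rewrite (_ : (2 * m).+1 = (m + m.+1)%N); last by lia.
rewrite big_split_ord /= [X in _ * X]big1 ?mulr1.
  apply: eq_bigr => k _; apply: eq_bigl => c; rewrite /p2_allowed.
  by have := ltn_ord k; lia.
move=> k _; rewrite (big_pred1 (Ordinal (nilp_order_gt0 qN0))) ?expr0 // => c.
by rewrite /p2_allowed /= -val_eqE /=; lia.
Qed.

Section GeneratingFunctions.

Variables (R : comNzRingType) (N : nat) (q : R).
Hypothesis qN0 : q ^+ N = 0.

Lemma signed_count_gf (allowed : nat -> nat -> nat -> bool) :
    (forall t k, allowed t k 0%N) ->
  \sum_(n < N | (0 < n)%N)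
    (signed_count (mult_admissible allowed) n)%:~R * q ^+ n =
  \sum_(m < N) q ^+ (2 * m.+1) * inv_subX N q (2 * m.+1) *
    \prod_(k < (2 * m).+1)
      \sum_(c < N | allowed (2 * m.+1)%N k.+1 c) (- q ^+ k.+1) ^+ c.
Proof.
move=> allowed0; pose a t := q ^+ t.+1 * inv_subX N q t.+1 *
  \prod_(k < t) \sum_(c < N | allowed t.+1 k.+1 c) (- q ^+ k.+1) ^+ c.
pose c t n : R := \sum_(s <- partitions n |
    (largest s == t.+1) && mults_allowed (allowed t.+1) t.+1 s)
  (-1) ^+ count (leq^~ t) s.
transitivity (\sum_(t < N | odd t) a t).
  transitivity (\sum_(t < N | odd t) \sum_(n < N) c t n * q ^+ n); last first.
    by apply: eq_bigr => t _; rewrite largest_part_gf.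
  rewrite exchange_big big_mkcond; apply: eq_bigr => n _ /=.
  rewrite -mulr_suml; case: posnP => [n0|n_gt0].
    rewrite big1 ?mul0r // => t _; rewrite /c n0 big1_seq // => s.
    move=> /andP[/andP[/eqP Lt _]]; rewrite mem_partitions.
    by move=> /largest_partition_leq; rewrite Lt.
  congr (_ * _); rewrite /signed_count rmorph_sum.
  rewrite (sum_partitions_largest _ (fun t => ~~ odd t)
    (fun t => mults_allowed (allowed t) t) (N := N)) ?n_gt0 ?ltn_ord //.
  apply: eq_big => [t|t _]; first exact: negbK.
  by apply: eq_bigr => s /andP[/eqP -> _]; apply: rmorph_sign.
rewrite sum_ord_odd => [|t leNt].
  by apply: eq_bigr => m _; rewrite /a mulnS.
by rewrite /a (nilp_expr0 qN0) ?mul0r ?leqW.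
Qed.

Lemma p1_gf : \sum_(n < N | (0 < n)%N) (p1 n)%:~R * q ^+ n = p1_series N q.
Proof.
under eq_bigr => n _ do rewrite p1E.
rewrite signed_count_gf //.
by apply: eq_bigr => m _; rewrite prod_p1_allowed.
Qed.

Lemma p2_gf : \sum_(n < N | (0 < n)%N) (p2 n)%:~R * q ^+ n = p2_series N q.
Proof.
under eq_bigr => n _ do rewrite p2E.
rewrite signed_count_gf //.
by apply: eq_bigr => m _; rewrite prod_p2_allowed.
Qed.

End GeneratingFunctions.

(** * Divisor sums and extraction of coefficients *)

Lemma sum_divisors (V : nmodType) N n (F : nat -> V) : (0 < n <= N)%N ->
  \sum_(d <- divisors n) F d = \sum_(i < N | (i.+1 %| n)%N) F i.+1.
Proof.
move=> /andP[n_gt0 le_nN].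
rewrite -(big_mkord (fun i => (i.+1 %| n)%N) (fun i => F i.+1)).
rewrite -[RHS]big_filter -(big_map S xpredT F); apply: perm_big.
apply: uniq_perm.
- exact: divisors_uniq.
- by rewrite map_inj_uniq ?filter_uniq ?iota_uniq //; apply: succn_inj.
move=> d; rewrite -dvdn_divisors //; apply/idP/mapP => [dn|[i + ->]].
  have d_gt0 := dvdn_gt0 n_gt0 dn; exists d.-1; last by rewrite prednK.
  rewrite mem_filter prednK // dn mem_index_iota /=.
  by have := dvdn_leq n_gt0 dn; lia.
by rewrite mem_filter => /andP[].
Qed.

Lemma lambert_gf (R : pzSemiRingType) N (q : R) (a : nat -> R) : q ^+ N = 0 ->
  \sum_(n < N | (0 < n)%N) (\sum_(d <- divisors n) a d) * q ^+ n =
  \sum_(i < N) \sum_(k < N) a i.+1 * q ^+ (k.+1 * i.+1).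
Proof.
move=> qN0; transitivity (\sum_(n < N | (0 < n)%N) \sum_(i < N)
    \sum_(k < N | (k.+1 * i.+1 == n)%N) a i.+1 * q ^+ (k.+1 * i.+1)).
  apply: eq_bigr => n n_gt0.
  rewrite (@sum_divisors _ N) ?n_gt0 1?ltnW //.
  rewrite mulr_suml big_mkcond; apply: eq_bigr => i _.
  case: ifPn => [/dvdnP[k nE]|not_dvd]; last first.
    rewrite big_pred0 // => k; apply: contraNF not_dvd => /eqP <-.
    exact: dvdn_mull.
  have k_gt0 : (0 < k)%N by move: n_gt0; rewrite nE; case: (k).
  have k_lt : (k.-1 < N)%N by have := ltn_ord n; rewrite nE; nia.
  rewrite (big_pred1 (Ordinal k_lt)) => [|j] /=; first by rewrite prednK // nE.
  by rewrite nE eqn_pmul2r // -val_eqE /=; lia.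
rewrite exchange_big; apply: eq_bigr => i _.
rewrite (exchange_big_dep xpredT) //=; apply: eq_bigr => k _.
have [lt_N|le_N] := ltnP (k.+1 * i.+1) N.
  by rewrite (big_pred1 (Ordinal lt_N)) // => n; rewrite /= -val_eqE /=; lia.
by rewrite (nilp_expr0 qN0 le_N) mulr0 big1.
Qed.

Lemma tau_diff n :
  (tau_o n)%:Z - (tau_e n)%:Z = \sum_(d <- divisors n) (-1) ^+ d.+1.
Proof.
rewrite /tau_o /tau_e -!sumn_count !sumnE !big_map -!natz !natr_sum -sumrB.
by apply: eq_bigr => d _; rewrite -signr_odd /=; case: (odd d).
Qed.

Lemma tau_gf (R : comNzRingType) N (q : R) : q ^+ N = 0 ->
  \sum_(n < N | (0 < n)%N) ((tau_o n)%:Z - (tau_e n)%:Z)%:~R * q ^+ n =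
  alt_lambert N q.
Proof.
move=> qN0; transitivity (\sum_(i < N) \sum_(k < N)
    (-1) ^+ i.+2 * q ^+ (k.+1 * i.+1)).
  rewrite -(lambert_gf (fun d => (-1) ^+ d.+1)) //; apply: eq_bigr => n _.
  rewrite tau_diff rmorph_sum; congr (_ * _); apply: eq_bigr => d _.
  exact: rmorph_sign.
rewrite exchange_big; apply: eq_bigr => k _; rewrite mulr_sumr.
apply: eq_bigr => i _; rewrite [in RHS]exprNn -exprM mulnS exprD !exprS.
by ring.
Qed.

Lemma in_qpolyXn_eq0_coef (R : comNzRingType) n (P : {poly R}) i :
  in_qpoly 'X^(n.+1) P = 0 -> (i <= n)%N -> P`_i = 0.
Proof.
move=> /(congr1 val) /=; rewrite mk_monic_Xn /= => rem0 le_in.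
have := Pdiv.RingMonic.rdivp_eq (monicXn R n.+1) P.
by rewrite rem0 addr0 => ->; rewrite coefMXn ltnS le_in.
Qed.

Lemma in_qpolyXn_nilp (R : comNzRingType) n :
  in_qpoly ('X^(n.+1) : {poly R}) 'X ^+ n.+1 = 0.
Proof.
rewrite -rmorphXn; apply: val_inj => /=.
by rewrite mk_monic_Xn Pdiv.RingMonic.rmodpp // monicXn.
Qed.

(* The constant term is left out, as p1 0 and p2 0 count the empty partition. *)
Definition gf_poly N (a : nat -> int) : {poly int} :=
  \poly_(n < N) (if (0 < n)%N then a n else 0).

Lemma in_qpoly_gf_poly N (h : {poly int}) (a : nat -> int) :
  in_qpoly h (gf_poly N a) =
  \sum_(n < N | (0 < n)%N) (a n)%:~R * in_qpoly h 'X ^+ n.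
Proof.
rewrite /gf_poly poly_def rmorph_sum [RHS]big_mkcond; apply: eq_bigr => n _ /=.
case: ifP => _; last by rewrite scale0r rmorph0.
by rewrite -[X in X *: _]intz scaler_int -mulrzl rmorphM rmorph_int rmorphXn.
Qed.

Lemma p1_sub_p1_succ n : (1 <= n)%N ->
  p1 n - p1 n.+1 = p2 n + (tau_e n)%:Z - (tau_o n)%:Z.
Proof.
move=> n_gt0; pose tau k := (tau_o k)%:Z - (tau_e k)%:Z.
pose gf := gf_poly n.+2.
pose P := (1 - 'X) * gf p1 + 'X * gf p2 - 'X * gf tau.
have P0 : in_qpoly 'X^(n.+2) P = 0.
  rewrite rmorphB rmorphD !rmorphM rmorphB rmorph1 /= !in_qpoly_gf_poly.
  have qN0 := in_qpolyXn_nilp int n.+1.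
  rewrite (p1_gf qN0) (p2_gf qN0) (tau_gf qN0).
  by rewrite (p1_series_p2_series qN0) subrr.
have := in_qpolyXn_eq0_coef P0 (leqnn n.+1).
rewrite /P mulrBl mul1r !(coefB, coefD) !coefXM !coef_poly.
by rewrite !ltnS leqnn leqnSn n_gt0 /= /tau; lia.
Qed.

Lemma p1_1 : p1 1 = 0.
Proof.
rewrite /p1 big1_seq // => s /andP[/and3P[even_L _ _]].
rewrite mem_partitions => ps; have := largest_partition_leq ps.
by have := largest_partition_gt0 ps isT; move: (largest s) even_L; lia.
Qed.

Theorem theorem1p3 :
  (forall n : nat, (1 <= n)%N ->
     p1 n - p1 n.+1 = p2 n + (tau_e n)%:Z - (tau_o n)%:Z)
  /\
  (forall N : nat, (1 <= N)%N ->
     p1 N = \sum_(1 <= n < N) ((tau_o n)%:Z - (tau_e n)%:Z - p2 n)).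
Proof.
split=> [n|N N_gt0]; first exact: p1_sub_p1_succ.
rewrite (telescope_sumr_eq p1) ?p1_1 ?subr0 // => n /andP[n_gt0 _].
by have := p1_sub_p1_succ n_gt0; lia.
Qed.
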